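(* Let $d=mk$ and let $\Omega_{\mathrm e}=\{Q\in\mathbb{R}_+^{m\times k}:\|Q\|_1=1\}$. Consider the closed-loop system, for $t\in\mathbb{Z}_+$, $$X_{t+1}=\mathcal{A}(X_t)+\mathcal{B}\bigl(\Theta\Psi(X_t,t)+U_t\bigr),\qquad U_t=-\mathcal{K}(X_t)-\widehat{\Theta}_t\Psi(X_t,t)+U_t^{\mathrm d},$$ with arbitrary initial state $X_0\in\mathbb{R}^{n_1\times n_2}$, where $\widehat\Theta_0=\mathbf{1}/d$ ($\mathbf 1$ being the all-ones $m\times k$ matrix) and $$\widehat{\Theta}_{t+1}=\frac{\widehat{\Theta}_t\odot\exp_{\mathrm{el}}\bigl(-\eta_{t+1}\nabla J_t(\widehat{\Theta}_t)\bigr)}{\bigl\|\widehat{\Theta}_t\odot\exp_{\mathrm{el}}\bigl(-\eta_{t+1}\nabla J_t(\widehat{\Theta}_t)\bigr)\bigr\|_1},\qquad \eta_{t+1}=\frac{2J_t(\widehat{\Theta}_t)}{\epsilon_{t+1}+\|\nabla J_t(\widehat{\Theta}_t)\|_\infty^2},$$ for a nonnegative bounded sequence $\{\epsilon_{t+1}\}_{t\in\mathbb{Z}_+}$. Suppose that $\Theta\in\Omega_{\mathrm e}$. Then for every integer $T\ge1$ the regret $\operatorname{Reg}(T):=\sum_{t=0}^{T-1}J_t(\widehat\Theta_t)$ satisfies $$\operatorname{Reg}(T)\le\sqrt{\frac{\ln(d)}2\sum_{t=0}^{T-1}\left(\epsilon_{t+1}+\|\nabla J_t(\widehat\Theta_t)\|_\infty^2\right)}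 .$$
   Context: Fix positive integers $n_1,n_2,m,k$. Matrix spaces carry the Frobenius inner product $\langle X,Y\rangle=\operatorname{Tr}(X^\top Y)$ and Frobenius norm $\|\cdot\|_{\mathrm F}$. $\mathcal{A}:\mathbb{R}^{n_1\times n_2}\to\mathbb{R}^{n_1\times n_2}$, $\mathcal{B}:\mathbb{R}^{m\times n_2}\to\mathbb{R}^{n_1\times n_2}$ and $\mathcal{K}:\mathbb{R}^{n_1\times n_2}\to\mathbb{R}^{m\times n_2}$ are linear operators such that $\mathcal{A}-\mathcal{B}\mathcal{K}$ (i.e. $X\mapsto\mathcal{A}(X)-\mathcal{B}(\mathcal{K}(X))$) is Schur stable (spectral radius $<1$). $\mathcal{B}^\top$ is the adjoint of $\mathcal{B}$: $\langle\mathcal{B}(U),V\rangle=\langle U,\mathcal{B}^\top(V)\rangle$. $\Psi:\mathbb{R}^{n_1\times n_2}\times\mathbb{Z}_+\to\mathbb{R}^{k\times n_2}$ is a map (the regressor), $\{U_t^{\mathrm d}\}_{t\in\mathbb{Z}_+}\subset\mathbb{R}^{m\times n_2}$ is a bounded sequence, and $\Theta$ is the fixed true parameter. Residual, loss and gradient: $$\widetilde X_{t+1}:=X_{t+1}-(\mathcal{A}-\mathcal{B}\mathcal{K})(X_t)-\mathcal{B}(U_t^{\mathrm d})=\mathcal{B}\bigl((\Theta-\widehat\Theta_t)\Psi(X_t,t)\bigr),$$ $$J_t(\widehat\Theta_t):=\tfrac12\bigl\|\mathcal{B}\bigl((\Theta-\widehat\Theta_t)\Psi(X_t,t)\bigr)\bigr\|_{\mathrm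 F}^2=\tfrac12\|\widetilde X_{t+1}\|_{\mathrm F}^2,\qquad \nabla J_t(\widehat\Theta_t)=-\mathcal{B}^\top(\widetilde X_{t+1})\Psi(X_t,t)^\top .$$ $\|Q\|_1=\sum_{i,j}|Q_{ij}|$ and $\|Q\|_\infty=\max_{i,j}|Q_{ij}|$ are entrywise norms, $\exp_{\mathrm{el}}$ is the entrywise exponential, $\odot$ is the Hadamard product, and $\mathbb{R}_+^{m\times k}$ is the set of matrices with nonnegative entries. Convention: if the denominator in the step size is zero (in which case $J_t(\widehat\Theta_t)=0$ too), set $\eta_{t+1}=0$. *)

(* Defs.v *)
From HB Require Import structures.
From mathcomp Require Import all_boot all_order all_algebra.
From mathcomp Require Import all_classical all_reals all_analysis.
From mathcomp Require Import complex.
From mathcomp Require Import ring lra.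

Set Implicit Arguments.
Unset Strict Implicit.
Unset Printing Implicit Defensive.

Import Order.TTheory GRing.Theory Num.Theory.
Import numFieldNormedType.Exports.

Local Open Scope classical_set_scope.
Local Open Scope ring_scope.

Definition frob (R : realType) (p q : nat) (X Y : 'M[R]_(p, q)) : R :=
  \tr (X^T *m Y).

Definition frob_norm (R : realType) (p q : nat) (X : 'M[R]_(p, q)) : R :=
  Num.sqrt (frob X X).

Definition norm1 (R : realType) (p q : nat) (Q : 'M[R]_(p, q)) : R :=
  \sum_i \sum_j `|Q i j|.

(* The entrywise max norm is the library's [mx_norm]; see [mx_normrE]. *)
Definition norm_inf (R : realType) (p q : nat) (Q : 'M[R]_(p, q)) : R :=
  mx_norm Q.

Definition exp_el (R : realType) (p q : nat) (Q : 'M[R]_(p, q)) : 'M[R]_(p, q) :=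
  map_mx (@expR R) Q.

Definition hadamard (R : realType) (p q : nat) (P Q : 'M[R]_(p, q)) :
    'M[R]_(p, q) :=
  map2_mx *%R P Q.

(* Spectral radius of an operator on real matrices: the largest modulus of its
   complex eigenvalues, i.e. the eigenvalues over R[i] of the matrix that
   represents it on row-vectorized matrices. The set is finite, and nonempty
   when 0 < p * q; [sup] returns 0 on the empty set. *)
Definition spectral_radius (R : realType) (p q : nat)
    (L : 'M[R]_(p, q) -> 'M[R]_(p, q)) : R :=
  sup [set ComplexField.Normc.normc z | z in
       [set z : R[i] | eigenvalue (map_mx (real_complex R) (lin_mx L)) z]].

Definition schur_stable (R : realType) (p q : nat)
    (L : {linear 'M[R]_(p, q) -> 'M[R]_(p, q)}) : Prop :=
  spectral_radius L < 1.

(* The adjoint for the Frobenius inner products, given by its matrix entries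
   <adjoint B V, E_ij> = <B E_ij, V>; it is characterized in [adjointP]. *)
Definition adjoint (R : realType) (p q r s : nat)
    (B : {linear 'M[R]_(p, q) -> 'M[R]_(r, s)}) (V : 'M[R]_(r, s)) :
    'M[R]_(p, q) :=
  \matrix_(i, j) frob (B (delta_mx i j)) V.

Definition loss (R : realType) (n1 n2 m k : nat)
    (B : {linear 'M[R]_(m, n2) -> 'M[R]_(n1, n2)})
    (Theta : 'M[R]_(m, k)) (psi : 'M[R]_(k, n2)) (Q : 'M[R]_(m, k)) : R :=
  2^-1 * frob_norm (B ((Theta - Q) *m psi)) ^+ 2.

(* [is_derive_loss] shows that this is the gradient of [loss] at Q for the
   Frobenius inner product. *)
Definition loss_grad (R : realType) (n1 n2 m k : nat)
    (B : {linear 'M[R]_(m, n2) -> 'M[R]_(n1, n2)})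
    (Theta : 'M[R]_(m, k)) (psi : 'M[R]_(k, n2)) (Q : 'M[R]_(m, k)) :
    'M[R]_(m, k) :=
  - (adjoint B (B ((Theta - Q) *m psi)) *m psi^T).

Definition step_size (R : realType) (p q : nat) (eps J : R)
    (G : 'M[R]_(p, q)) : R :=
  let den := eps + norm_inf G ^+ 2 in
  if den == 0 then 0 else 2 * J / den.

Definition exp_gradient_step (R : realType) (p q : nat) (eta : R)
    (G Q : 'M[R]_(p, q)) : 'M[R]_(p, q) :=
  let W := hadamard Q (exp_el (- eta *: G)) in (norm1 W)^-1 *: W.

Definition entrywise_simplex (R : realType) (p q : nat) : set 'M[R]_(p, q) :=
  [set Q : 'M[R]_(p, q) | (forall i j, 0 <= Q i j) /\ norm1 Q = 1].

Definition residual (R : realType) (n1 n2 m : nat)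
    (A : {linear 'M[R]_(n1, n2) -> 'M[R]_(n1, n2)})
    (B : {linear 'M[R]_(m, n2) -> 'M[R]_(n1, n2)})
    (K : {linear 'M[R]_(n1, n2) -> 'M[R]_(m, n2)})
    (Xnext X : 'M[R]_(n1, n2)) (Ud : 'M[R]_(m, n2)) : 'M[R]_(n1, n2) :=
  Xnext - (A \- (B \o K)) X - B Ud.

Lemma frobE (R : realType) (p q : nat) (X Y : 'M[R]_(p, q)) :
  frob X Y = \sum_i \sum_j X i j * Y i j.
Proof.
rewrite /frob /mxtrace exchange_big /=; apply: eq_bigr => j _.
by rewrite mxE; apply: eq_bigr => i _; rewrite mxE.
Qed.

Lemma frobC (R : realType) (p q : nat) (X Y : 'M[R]_(p, q)) :
  frob X Y = frob Y X.
Proof.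
by rewrite !frobE; do 2 (apply: eq_bigr => ? _); rewrite mulrC.
Qed.

Lemma frobDr (R : realType) (p q : nat) (X Y Z : 'M[R]_(p, q)) :
  frob X (Y + Z) = frob X Y + frob X Z.
Proof. by rewrite /frob mulmxDr mxtraceD. Qed.

Lemma frobZr (R : realType) (p q : nat) (a : R) (X Y : 'M[R]_(p, q)) :
  frob X (a *: Y) = a * frob X Y.
Proof. by rewrite /frob -scalemxAr mxtraceZ. Qed.

Lemma frobXX_ge0 (R : realType) (p q : nat) (X : 'M[R]_(p, q)) :
  0 <= frob X X.
Proof.
by rewrite frobE; do 2 (apply: sumr_ge0 => ? _); rewrite -expr2 sqr_ge0.
Qed.

Lemma frob_norm_sqr (R : realType) (p q : nat) (X : 'M[R]_(p, q)) :
  frob_norm X ^+ 2 = frob X X.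
Proof. by rewrite sqr_sqrtr ?frobXX_ge0. Qed.

Lemma adjointP (R : realType) (p q r s : nat)
    (B : {linear 'M[R]_(p, q) -> 'M[R]_(r, s)}) U V :
  frob (B U) V = frob U (adjoint B V).
Proof.
rewrite [in LHS](matrix_sum_delta U) linear_sum frobC /frob mulmx_sumr.
rewrite linear_sum -/(frob _ _) frobE; apply: eq_bigr => i _ /=.
rewrite linear_sum mulmx_sumr linear_sum /=; apply: eq_bigr => j _.
by rewrite linearZ /= -/(frob _ _) frobZr mxE frobC.
Qed.

Lemma residualE (R : realType) (n1 n2 m k : nat)
    (A : {linear 'M[R]_(n1, n2) -> 'M[R]_(n1, n2)})
    (B : {linear 'M[R]_(m, n2) -> 'M[R]_(n1, n2)})
    (K : {linear 'M[R]_(n1, n2) -> 'M[R]_(m, n2)})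
    (Theta Q : 'M[R]_(m, k)) (psi : 'M[R]_(k, n2)) X Xnext U Ud :
  Xnext = A X + B (Theta *m psi + U) -> U = - K X - Q *m psi + Ud ->
  residual A B K Xnext X Ud = B ((Theta - Q) *m psi).
Proof.
move=> -> ->; rewrite /residual /= mulmxBl !(linearD, linearN) /=.
by apply/matrixP => i j; rewrite !mxE; ring.
Qed.

Lemma is_derive_loss (R : realType) (n1 n2 m k : nat)
    (B : {linear 'M[R]_(m, n2) -> 'M[R]_(n1, n2)})
    (Theta Q D : 'M[R]_(m, k)) (psi : 'M[R]_(k, n2)) :
  is_derive Q D (loss B Theta psi) (frob (loss_grad B Theta psi Q) D).
Proof.
set g := frob _ D; pose E := B ((Theta - Q) *m psi).
pose c := frob (B (D *m psi)) (B (D *m psi)).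
have gE : g = - frob E (B (D *m psi)).
  rewrite /g frobC /loss_grad -scaleN1r frobZr mulN1r; congr (- _).
  rewrite [RHS]frobC adjointP /frob trmx_mul -!mulmxA.
  by rewrite [RHS]mxtrace_mulC mulmxA.
have key (h : R) : loss B Theta psi (h *: D + Q) - loss B Theta psi Q =
    h * g + h ^+ 2 * (c / 2).
  have -> : loss B Theta psi (h *: D + Q) =
      2^-1 * (frob E E - 2 * h * frob E (B (D *m psi)) + h ^+ 2 * c).
    rewrite /loss frob_norm_sqr; congr (_ * _).
    have -> : B ((Theta - (h *: D + Q)) *m psi) = E + (- h) *: B (D *m psi).
      rewrite /E -linearZ -linearD; congr (B _).
      rewrite scalemxAl -mulmxDl; congr (_ *m _).
      by apply/matrixP => i j; rewrite !mxE; ring.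
    rewrite frobDr frobZr [frob _ E]frobC frobDr frobZr.
    rewrite [frob (_ + _) (B _)]frobC frobDr frobZr -/c [frob (B _) E]frobC.
    by ring.
  by rewrite /loss frob_norm_sqr -/E gE; field.
have lim : (fun h : R => h^-1 *: ((loss B Theta psi \o shift Q) (h *: D)
    - loss B Theta psi Q)) @ 0^' --> g.
  apply: (@cvg_trans _ ((fun h : R => g + h * (c / 2)) @ 0^')).
    apply: near_eq_cvg; near=> h.
    have h0 : h != 0 by near: h; exact: nbhs_dnbhs_neq.
    by rewrite /= key /GRing.scale /=; field.
  have -> : g = g + 0 * (c / 2) by rewrite mul0r addr0.
  apply: cvg_within_filter; apply: cvgD.
    by rewrite mul0r addr0; exact: cvg_cst.
  by apply: cvgM; [exact: cvg_id|exact: cvg_cst].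
by split; [apply/cvg_ex; exists g|exact: cvg_lim].
Unshelve. all: by end_near. Qed.

(* Main.v *)
Require Import Defs.
From mathcomp Require Import all_boot all_order all_algebra.
From mathcomp Require Import all_classical all_reals all_analysis.
From mathcomp Require Import ring lra.

Import Order.TTheory GRing.Theory Num.Theory.
Import numFieldNormedType.Exports.

Local Open Scope classical_set_scope.
Local Open Scope ring_scope.

(** The update is exponentiated-gradient (entropic mirror) descent on the
    simplex, and the Lyapunov function is the relative entropy of [Theta] with
    respect to the current estimate. Its part that depends only on [Theta] is
    constant in time, so the cross entropy
    [V t = - \sum_ij Theta_ij ln (That t)_ij] is used instead: it starts at
    [ln (m * k)] because the initial estimate is uniform, and it stays
    nonnegative because the entries of a point of the simplex are at most 1.

    One step multiplies by [exp (- eta G)] and normalizes by a partition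
    function Z, so that V changes by [eta <G, Theta> + ln Z]. Hoeffding's lemma
    bounds [ln Z] by [- eta <G, That> + eta^2 |G|_inf^2 / 2]. The loss is a
    quadratic form in [Theta - That], hence [<G, That - Theta> = 2 J], and the
    change of V is at most [- 2 eta J + eta^2 |G|_inf^2 / 2]. The step size
    satisfies [eta |G|_inf^2 <= 2 J], which leaves a decrease of at least
    [eta J] ([cross_entropy_decrease]). Telescoping gives
    [\sum_t eta J <= ln (m * k)].

    Finally [J^2 = (eta J / 2) (eps + |G|_inf^2)], also when the denominator
    vanishes, since then the gradient and with it the loss are zero
    ([step_size_sqr]); the Cauchy-Schwarz inequality over t turns the
    telescoped bound into the regret bound. *)

(** * Hoeffding's lemma for finite sums *)

Lemma ge0_of_derive_ge0 {R : realType} {f df : R -> R} {c : R} :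
  (forall x : R, is_derive x 1 f (df x)) -> (forall x, 0 <= x -> 0 <= df x) ->
  f 0 = 0 -> 0 <= c -> 0 <= f c.
Proof.
move=> fD df_ge0 f0 c_ge0.
have [|x + fcE] := MVT_segment c_ge0 (fun x _ => fD x).
  apply: continuous_subspaceT => x.
  have [fdx _] := fD x.
  exact/differentiable_continuous/derivable1_diffP.
rewrite in_itv /= => /andP[x_ge0 _].
by move: fcE; rewrite f0 !subr0 => ->; rewrite mulr_ge0 // df_ge0.
Qed.

(** With [phi s = p e^s + q e^-s], the defect
    [h s = (p - q) s + s^2 / 2 - ln (phi s)] vanishes at 0 to first order,
    and its second derivative is [1 - (1 - (phi' / phi)^2)], a square, because
    [phi'' = phi]. Integrating the sign twice gives [0 <= h]. *)
Lemma two_point_hoeffding {R : realType} {p q c : R} :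
  0 <= p -> 0 <= q -> p + q = 1 -> 0 <= c ->
  p * expR c + q * expR (- c) <= expR ((p - q) * c + c ^+ 2 / 2).
Proof.
move=> p_ge0 q_ge0 pq1 c_ge0.
pose phi (s : R) : R := p * expR s + q * expR (- s).
pose psi (s : R) : R := p * expR s - q * expR (- s).
have phi_gt0 (s : R) : 0 < phi s.
  rewrite /phi; have := expR_gt0 s; have := expR_gt0 (- s).
  by have [p_le0|p_gt0] := leP p 0; nra.
have phiD (s : R) : is_derive s 1 phi (psi s).
  by rewrite /phi /psi; apply: is_derive_eq; rewrite /GRing.scale /=; ring.
have psiD (s : R) : is_derive s 1 psi (phi s).
  by rewrite /phi /psi; apply: is_derive_eq; rewrite /GRing.scale /=; ring.
pose g (s : R) := (p - q) + s - psi s / phi s.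
have gD (s : R) : is_derive s 1 g ((psi s / phi s) ^+ 2).
  have phi_neq0 : phi s != 0 by rewrite gt_eqF.
  have invD := is_deriveV phi_neq0 (phiD s).
  by rewrite /g; apply: is_derive_eq; rewrite /GRing.scale /=; field.
have g_ge0 (s : R) : 0 <= s -> 0 <= g s.
  apply: ge0_of_derive_ge0 gD _ _ => [x _|]; first exact: sqr_ge0.
  by rewrite /g /phi /psi /= expRN expR0 invr1 !mulr1 pq1 divr1; ring.
have hD (s : R) : is_derive s 1
    (fun s : R => (p - q) * s + s ^+ 2 / 2 - ln (phi s)) (g s).
  have lnD := is_derive1_ln (phi_gt0 s).
  have compD := is_derive1_comp lnD (phiD s).
  by rewrite /g; apply: is_derive_eq; rewrite /GRing.scale /=; field;
    rewrite gt_eqF.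
have := ge0_of_derive_ge0 hD g_ge0 _ c_ge0.
rewrite subr_ge0 -ler_expR lnK ?posrE //; apply.
by rewrite /phi oppr0 expR0 !mulr1 pq1 ln1; ring.
Qed.

(** Convexity of the exponential: [x] is the mean of [c] and [- c] with the
    weights displayed, so its exponential lies below the chord. *)
Lemma expR_le_chord {R : realType} {c x : R} : 0 < c -> `|x| <= c ->
  expR x <= (1 + x / c) / 2 * expR c + (1 - x / c) / 2 * expR (- c).
Proof.
move=> c_gt0; rewrite ler_norml => /andP[cx xc].
have xc_le1 : x / c <= 1 by rewrite ler_pdivrMr // mul1r.
have xc_geN1 : -1 <= x / c by rewrite ler_pdivlMr // mulN1r.
have t_ge0 : 0 <= (1 + x / c) / 2 by lra.
have t_le1 : (1 + x / c) / 2 <= 1 by lra.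
have := convex_expR (Itv01 t_ge0 t_le1) c (- c).
rewrite !convRE /= /unstable.onem.
have -> : (1 + x / c) / 2 * c + (1 - (1 + x / c) / 2) * - c = x.
  by field; rewrite gt_eqF.
by have -> : (1 - x / c) / 2 = 1 - (1 + x / c) / 2 by field; rewrite gt_eqF.
Qed.

(** The chord bound is affine in [f i], so averaging it reduces an arbitrary
    distribution on [- c, c] to the two-point distribution on the ends of the
    interval that has the same mean. *)
Lemma hoeffding_lemma {R : realType} {I : finType} {w f : I -> R} {c : R} :
  (forall i, 0 <= w i) -> \sum_i w i = 1 -> (forall i, `|f i| <= c) ->
  \sum_i w i * expR (f i) <= expR (\sum_i w i * f i + c ^+ 2 / 2).
Proof.
move=> w_ge0 w1 fc.
have c_ge0 : 0 <= c.
  have [i _|I0] := pickP (mem I); first exact: le_trans (fc i).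
  by move: w1; rewrite big_pred0 // => /esym/eqP; rewrite oner_eq0.
(* The chord through the ends of [- c, c] degenerates when [c = 0]. *)
have [c0|c_neq0] := eqVneq c 0.
  have f0 i : f i = 0 by apply/normr0_eq0/le_anti; rewrite normr_ge0 -c0 fc.
  under eq_bigr do rewrite f0 expR0 mulr1.
  under [in leRHS]eq_bigr do rewrite f0 mulr0.
  by rewrite w1 big1 // c0 add0r expr0n mul0r expR0.
have c_gt0 : 0 < c by rewrite lt0r c_neq0.
pose mu := \sum_i w i * f i.
have muc : `|mu| <= c.
  rewrite -[c]mul1r -w1 mulr_suml.
  apply: le_trans (ler_norm_sum _ _ _) _; apply: ler_sum => i _.
  by rewrite normrM ger0_norm // ler_wpM2l.
have le_avg : \sum_i w i * expR (f i) <=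
    (1 + mu / c) / 2 * expR c + (1 - mu / c) / 2 * expR (- c).
  have -> : (1 + mu / c) / 2 * expR c + (1 - mu / c) / 2 * expR (- c) =
      \sum_i w i * ((1 + f i / c) / 2 * expR c
        + (1 - f i / c) / 2 * expR (- c)).
    transitivity (\sum_i (w i * ((expR c + expR (- c)) / 2)
        + w i * f i * ((expR c - expR (- c)) / (2 * c)))).
      by rewrite big_split /= -!mulr_suml w1 -/mu; field.
    by apply: eq_bigr => i _; field.
  by apply: ler_sum => i _; rewrite ler_wpM2l // expR_le_chord.
apply: le_trans le_avg _.
move: muc; rewrite ler_norml => /andP[cmu muc].
have muc1 : mu / c <= 1 by rewrite ler_pdivrMr // mul1r.
have muc2 : -1 <= mu / c by rewrite ler_pdivlMr // mulN1r.
have p_ge0 : 0 <= (1 + mu / c) / 2 by lra.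
have q_ge0 : 0 <= (1 - mu / c) / 2 by lra.
have pq1 : (1 + mu / c) / 2 + (1 - mu / c) / 2 = 1 by field.
apply: le_trans (two_point_hoeffding p_ge0 q_ge0 pq1 c_ge0) _.
by have -> : ((1 + mu / c) / 2 - (1 - mu / c) / 2) * c = mu by field.
Qed.

(** * The Cauchy-Schwarz inequality in product form *)

(** Bounding [a t ^ 2] by a product instead of dividing by [d t] keeps the
    inequality usable at times where the weight [d t] is zero. *)
Lemma cauchy_schwarz_sum {R : realType} {a b d : nat -> R} (T : nat) :
  (forall t, 0 <= b t) -> (forall t, 0 <= d t) ->
  (forall t, a t ^+ 2 <= b t * d t) ->
  (\sum_(0 <= t < T) a t) ^+ 2 <=
    (\sum_(0 <= t < T) b t) * (\sum_(0 <= t < T) d t).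
Proof.
move=> b_ge0 d_ge0 abd; elim: T => [|T IH].
  by rewrite !big_geq // expr0n mulr0.
rewrite !big_nat_recr //=.
move: IH (abd T) (b_ge0 T) (d_ge0 T).
have : 0 <= \sum_(0 <= t < T) b t by apply: sumr_ge0.
have : 0 <= \sum_(0 <= t < T) d t by apply: sumr_ge0.
move: (\sum_(0 <= t < T) a t) (\sum_(0 <= t < T) b t) (\sum_(0 <= t < T) d t).
move: (a T) (b T) (d T) => x y z A B D D_ge0 B_ge0 ABD xyz y_ge0 z_ge0.
(* (B z + y D)^2 exceeds 4 (B D) (y z) by (B z - y D)^2. *)
have cross : 2 * (A * x) <= B * z + y * D.
  apply: le_trans (ler_norm _) _.
  rewrite -ler_sqr ?nnegrE ?addr_ge0 ?mulr_ge0 // real_normK ?num_real //.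
  have : (A ^+ 2) * (x ^+ 2) <= (B * D) * (y * z) by rewrite ler_pM ?sqr_ge0.
  by have := sqr_ge0 (B * z - y * D); nra.
nra.
Qed.

(** * Norms, loss and gradient *)

Lemma entry_le_norm_inf {R : realType} {p q : nat} (G : 'M[R]_(p, q)) i j :
  `|G i j| <= norm_inf G.
Proof.
rewrite /norm_inf mx_normrE.
exact: (le_bigmax _ (fun ij : 'I_p * 'I_q => `|G ij.1 ij.2|) (i, j)).
Qed.

Lemma norm1_gt0E {R : realType} {p q : nat} {Q : 'M[R]_(p, q)} :
  (forall i j, 0 < Q i j) -> norm1 Q = \sum_i \sum_j Q i j.
Proof.
move=> Q_gt0; apply: eq_bigr => i _; apply: eq_bigr => j _.
by rewrite ger0_norm ?ltW.
Qed.

Lemma loss_ge0 {R : realType} {n1 n2 m k : nat}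
    (B : {linear 'M[R]_(m, n2) -> 'M[R]_(n1, n2)})
    (Theta : 'M[R]_(m, k)) (psi : 'M[R]_(k, n2)) (Q : 'M[R]_(m, k)) :
  0 <= loss B Theta psi Q.
Proof. by rewrite mulr_ge0 ?invr_ge0 ?sqr_ge0. Qed.

(** The loss is half a quadratic form centred at [Theta], so its derivative in
    the direction [Q - Theta] is twice its value (Euler's identity). *)
Lemma loss_grad_dot {R : realType} {n1 n2 m k : nat}
    (B : {linear 'M[R]_(m, n2) -> 'M[R]_(n1, n2)})
    (Theta : 'M[R]_(m, k)) (psi : 'M[R]_(k, n2)) (Q : 'M[R]_(m, k)) :
  frob (loss_grad B Theta psi Q) Q - frob (loss_grad B Theta psi Q) Theta =
  2 * loss B Theta psi Q.
Proof.
rewrite /loss frob_norm_sqr mulrA divff // mul1r adjointP.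
rewrite -mulN1r -frobZr -frobDr scaleN1r -opprB frobC /loss_grad.
rewrite /frob [_^T]raddfN /= mulNmx mulmxN opprK trmx_mul -!mulmxA.
by rewrite [RHS]mxtrace_mulC mulmxA.
Qed.

(** * The exponentiated-gradient step *)

(** This differs from the relative entropy by a constant in [Q], and involves
    no logarithm of an entry of [Theta], which may be zero. *)
Definition cross_entropy {R : realType} {p q : nat}
    (Theta Q : 'M[R]_(p, q)) : R :=
  - \sum_i \sum_j Theta i j * ln (Q i j).

Definition partition_fun {R : realType} {p q : nat}
    (eta : R) (G Q : 'M[R]_(p, q)) : R :=
  norm1 (hadamard Q (exp_el (- eta *: G))).

Lemma partition_funE {R : realType} {p q : nat}
    {eta : R} {G Q : 'M[R]_(p, q)} : (forall i j, 0 < Q i j) ->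
  partition_fun eta G Q =
  \sum_(ij : 'I_p * 'I_q) Q ij.1 ij.2 * expR (- eta * G ij.1 ij.2).
Proof.
move=> Q_gt0; rewrite /partition_fun norm1_gt0E => [|i j].
  by rewrite pair_bigA /=; apply: eq_bigr => ij _; rewrite !mxE.
by rewrite !mxE mulr_gt0 // expR_gt0.
Qed.

Lemma partition_fun_gt0 {R : realType} {p q : nat}
    (eta : R) (G : 'M[R]_(p, q)) {Q : 'M[R]_(p, q)} :
  (forall i j, 0 < Q i j) -> norm1 Q = 1 ->
  0 < partition_fun eta G Q.
Proof.
move=> Q_gt0 Q1; rewrite partition_funE //.
have [ij _|no_entry] := pickP (fun _ : 'I_p * 'I_q => true).
  rewrite (bigD1 ij) //= ltr_wpDr //; last by rewrite mulr_gt0 // expR_gt0.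
  by apply: sumr_ge0 => ? _; rewrite mulr_ge0 ?expR_ge0 // ltW.
have := Q1; rewrite norm1_gt0E // pair_bigA big_pred0 => [/esym/eqP|ij].
  by rewrite oner_eq0.
by have := no_entry ij.
Qed.

(** The partition function is the mean of [exp (- eta G)] under the
    distribution [Q], whose exponents are bounded by [|eta| |G|_inf]. *)
Lemma ln_partition_fun_le {R : realType} {p q : nat}
    (eta : R) (G : 'M[R]_(p, q)) {Q : 'M[R]_(p, q)} :
  (forall i j, 0 < Q i j) -> norm1 Q = 1 ->
  ln (partition_fun eta G Q) <=
    - eta * frob G Q + (eta * norm_inf G) ^+ 2 / 2.
Proof.
move=> Q_gt0 Q1; rewrite -ler_expR lnK; last by rewrite posrE partition_fun_gt0.
rewrite partition_funE // -[(_ * _) ^+ 2]real_normK ?num_real //.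
have -> : - eta * frob G Q =
    \sum_(ij : 'I_p * 'I_q) Q ij.1 ij.2 * (- eta * G ij.1 ij.2).
  rewrite frobE pair_bigA mulr_sumr; apply: eq_bigr => ij _ /=; ring.
apply: hoeffding_lemma => [ij||ij]; first exact: ltW.
  by rewrite -Q1 norm1_gt0E // pair_bigA.
rewrite normrM normrN normrM ler_wpM2l //.
by apply: le_trans (ler_norm _); exact: entry_le_norm_inf.
Qed.

(** Strict positivity, rather than membership in the closed simplex, is the
    invariant to propagate: the logarithm turns products into sums only at
    positive arguments. *)
Lemma exp_gradient_step_gt0 {R : realType} {p q : nat}
    {eta : R} {G Q : 'M[R]_(p, q)} :
  (forall i j, 0 < Q i j) -> norm1 Q = 1 ->
  forall i j, 0 < exp_gradient_step eta G Q i j.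
Proof.
move=> Q_gt0 Q1 i j; rewrite !mxE mulr_gt0 ?invr_gt0 ?mulr_gt0 ?expR_gt0 //.
exact: partition_fun_gt0.
Qed.

Lemma norm1_exp_gradient_step {R : realType} {p q : nat}
    {eta : R} {G Q : 'M[R]_(p, q)} : (forall i j, 0 < Q i j) ->
  norm1 Q = 1 -> norm1 (exp_gradient_step eta G Q) = 1.
Proof.
move=> Q_gt0 Q1; have Z_gt0 := partition_fun_gt0 eta G Q_gt0 Q1.
rewrite norm1_gt0E; last exact: exp_gradient_step_gt0.
under eq_bigr => i _.
  under eq_bigr do rewrite mxE.
  rewrite -mulr_sumr; over.
rewrite -mulr_sumr -norm1_gt0E ?mulVf ?gt_eqF // => i j.
by rewrite !mxE mulr_gt0 ?expR_gt0.
Qed.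

(** The logarithm of the new estimate is affine in the gradient, up to the
    normalization; averaging it against [Theta], of total mass 1, gives the
    change exactly. *)
Lemma cross_entropy_exp_gradient_step {R : realType} {p q : nat}
    {eta : R} {G Q Theta : 'M[R]_(p, q)} :
  (forall i j, 0 < Q i j) -> norm1 Q = 1 -> entrywise_simplex Theta ->
  cross_entropy Theta (exp_gradient_step eta G Q) =
  cross_entropy Theta Q + eta * frob G Theta + ln (partition_fun eta G Q).
Proof.
move=> Q_gt0 Q1 [ge0_Theta Theta1].
have Z_gt0 := partition_fun_gt0 eta G Q_gt0 Q1.
have Theta_sum : \sum_i \sum_j Theta i j = 1.
  rewrite -Theta1; apply: eq_bigr => i _; apply: eq_bigr => j _.
  by rewrite ger0_norm.
rewrite /cross_entropy frobE -[ln (partition_fun _ _ _)]mul1r -Theta_sum.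
rewrite !pair_bigA -!sumrN mulr_sumr mulr_suml -!big_split /=.
apply: eq_bigr => ij _; rewrite 3!mxE -/(partition_fun eta G Q) !mxE.
rewrite lnM ?posrE ?invr_gt0 ?mulr_gt0 ?expR_gt0 // lnV ?posrE //.
by rewrite lnM ?posrE ?expR_gt0 // expRK; ring.
Qed.

Lemma cross_entropy_ge0 {R : realType} {p q : nat}
    {Q Theta : 'M[R]_(p, q)} :
  (forall i j, 0 < Q i j) -> norm1 Q = 1 -> entrywise_simplex Theta ->
  0 <= cross_entropy Theta Q.
Proof.
move=> Q_gt0 Q1 [ge0_Theta _]; rewrite oppr_ge0.
apply: sumr_le0 => i _; apply: sumr_le0 => j _; rewrite mulr_ge0_le0 //.
apply: ln_le0; rewrite -Q1 norm1_gt0E // (bigD1 i) //= (bigD1 j) //= -addrA.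
rewrite lerDl addr_ge0 ?sumr_ge0 // => [j' _|i' _]; first exact: ltW.
by apply: sumr_ge0 => j' _; exact: ltW.
Qed.

Lemma cross_entropy_uniform {R : realType} {p q : nat}
    {Theta : 'M[R]_(p, q)} {c : R} : entrywise_simplex Theta ->
  cross_entropy Theta (const_mx c^-1) = - ln c^-1.
Proof.
move=> [ge0_Theta Theta1]; rewrite /cross_entropy -[in RHS](mul1r (ln _)).
congr (- _); rewrite -Theta1 mulr_suml; apply: eq_bigr => i _.
by rewrite mulr_suml; apply: eq_bigr => j _; rewrite mxE ger0_norm.
Qed.

(** The premise on [J] is what makes the convention of a zero step harmless:
    a zero denominator forces [norm_inf G = 0], so both sides vanish. *)
Lemma step_size_sqr {R : realType} {p q : nat}
    {eps J : R} {G : 'M[R]_(p, q)} : 0 <= eps ->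
  (norm_inf G = 0 -> J = 0) ->
  J ^+ 2 = step_size eps J G * J / 2 * (eps + norm_inf G ^+ 2).
Proof.
move=> eps_ge0 J0; rewrite /step_size.
have [den0|den_neq0] := eqVneq; last by field.
rewrite J0 ?mulr0 ?mul0r ?expr0n //=.
by apply/eqP; rewrite -sqrf_eq0; apply/eqP; have := sqr_ge0 (norm_inf G); lra.
Qed.

(** The first-order gain is [2 eta J], and the step size is chosen so that the
    second-order loss [eta^2 |G|_inf^2 / 2] takes back at most half of it. *)
Lemma cross_entropy_decrease {R : realType} {p q : nat}
    {eps J : R} {G Q Theta : 'M[R]_(p, q)} :
  (forall i j, 0 < Q i j) -> norm1 Q = 1 -> entrywise_simplex Theta ->
  0 <= eps -> 0 <= J -> frob G Q - frob G Theta = 2 * J ->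
  step_size eps J G * J <= cross_entropy Theta Q -
    cross_entropy Theta (exp_gradient_step (step_size eps J G) G Q).
Proof.
move=> Q_gt0 Q1 Theta_in eps_ge0 J_ge0 dotJ.
rewrite cross_entropy_exp_gradient_step //.
set eta := step_size eps J G.
have := ln_partition_fun_le eta G Q_gt0 Q1.
have M2_ge0 := sqr_ge0 (norm_inf G).
have eta_ge0 : 0 <= eta.
  rewrite /eta /step_size; case: ifP => // _.
  by rewrite divr_ge0 ?mulr_ge0 ?addr_ge0.
have etaM : eta * norm_inf G ^+ 2 <= 2 * J.
  rewrite /eta /step_size; have [_|den_neq0] := eqVneq.
    by rewrite mul0r mulr_ge0.
  have den_gt0 : 0 < eps + norm_inf G ^+ 2 by rewrite lt0r den_neq0 addr_ge0.
  by rewrite mulrAC ler_pdivrMr // ler_wpM2l ?mulr_ge0 // lerDr.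
have : eta * (eta * norm_inf G ^+ 2) <= eta * (2 * J) by rewrite ler_wpM2l.
have -> : frob G Q = frob G Theta + 2 * J by rewrite -dotJ; ring.
rewrite exprMn; lra.
Qed.

(** * The regret bound *)

Theorem corollary7 (R : realType) (n1 n2 m k : nat)
    (n1_gt0 : (0 < n1)%N) (n2_gt0 : (0 < n2)%N)
    (m_gt0 : (0 < m)%N) (k_gt0 : (0 < k)%N)
    (A : {linear 'M[R]_(n1, n2) -> 'M[R]_(n1, n2)})
    (B : {linear 'M[R]_(m, n2) -> 'M[R]_(n1, n2)})
    (K : {linear 'M[R]_(n1, n2) -> 'M[R]_(m, n2)})
    (stable : schur_stable (A \- (B \o K)))
    (Psi : 'M[R]_(n1, n2) -> nat -> 'M[R]_(k, n2))
    (Ud : nat -> 'M[R]_(m, n2)) (Ud_bounded : bounded_fun Ud)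
    (Theta : 'M[R]_(m, k)) (Theta_in : entrywise_simplex Theta)
    (eps : nat -> R) (eps_ge0 : forall t, 0 <= eps t.+1)
    (eps_bounded : bounded_fun (fun t => eps t.+1))
    (X : nat -> 'M[R]_(n1, n2)) (U : nat -> 'M[R]_(m, n2))
    (That : nat -> 'M[R]_(m, k)) (eta : nat -> R)
    (J : nat -> 'M[R]_(m, k) -> R) (gradJ : nat -> 'M[R]_(m, k) -> 'M[R]_(m, k))
    (J_def : forall t Q, J t Q = loss B Theta (Psi (X t) t) Q)
    (gradJ_def : forall t Q, gradJ t Q = loss_grad B Theta (Psi (X t) t) Q)
    (X_next : forall t, X t.+1 = A (X t) + B (Theta *m Psi (X t) t + U t))
    (U_def : forall t, U t = - K (X t) - That t *m Psi (X t) t + Ud t)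
    (That_0 : That 0%N = const_mx ((m * k)%:R^-1))
    (That_next : forall t,
       That t.+1 = exp_gradient_step (eta t.+1) (gradJ t (That t)) (That t))
    (eta_next : forall t,
       eta t.+1 = step_size (eps t.+1) (J t (That t)) (gradJ t (That t)))
    (T : nat) (T_ge1 : (1 <= T)%N) :
  \sum_(0 <= t < T) J t (That t) <=
    Num.sqrt (ln ((m * k)%:R : R) / 2 *
              \sum_(0 <= t < T)
                 (eps t.+1 + norm_inf (gradJ t (That t)) ^+ 2)).
Proof.
have d_gt0 : 0 < (m * k)%:R :> R by rewrite ltr0n muln_gt0 m_gt0.
have That_simplex t : (forall i j, 0 < That t i j) /\ norm1 (That t) = 1.
  elim: t => [|t [Q_gt0 Q1]].
    have Q_gt0 i j : 0 < That 0%N i j by rewrite That_0 mxE invr_gt0.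
    split=> //; rewrite norm1_gt0E // That_0.
    under eq_bigr => i _ do rewrite (eq_bigr _ (fun j _ => mxE _ _ _ _)) /=.
    rewrite !sumr_const !card_ord -mulrnA.
    by rewrite -[LHS]mulr_natl (mulnC k) divff ?gt_eqF.
  by rewrite That_next; split;
    [exact: exp_gradient_step_gt0|exact: norm1_exp_gradient_step].
have J_ge0 t : 0 <= J t (That t) by rewrite J_def loss_ge0.
have dotJ t : frob (gradJ t (That t)) (That t) - frob (gradJ t (That t)) Theta =
    2 * J t (That t) by rewrite J_def gradJ_def loss_grad_dot.
have J0 t : norm_inf (gradJ t (That t)) = 0 -> J t (That t) = 0.
  move=> /mx_norm_eq0 grad0; have := dotJ t.
  rewrite grad0 /frob trmx0 !mul0mx mxtrace0; lra.
(* The Cauchy-Schwarz factors: J_t^2 = b_t d_t. *)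
pose b t := eta t.+1 * J t (That t) / 2.
pose d t := eps t.+1 + norm_inf (gradJ t (That t)) ^+ 2.
have d_ge0 t : 0 <= d t by rewrite addr_ge0 ?sqr_ge0.
have b_ge0 t : 0 <= b t.
  rewrite /b eta_next /step_size; case: eqVneq => _; first by rewrite !mul0r.
  by rewrite divr_ge0 // mulr_ge0 // divr_ge0 ?mulr_ge0 ?d_ge0.
have b_sum : \sum_(0 <= t < T) b t <= ln ((m * k)%:R : R) / 2.
  rewrite -mulr_suml ler_pM2r ?invr_gt0 //.
  apply: (@le_trans _ _ (\sum_(0 <= t < T)
      (cross_entropy Theta (That t) - cross_entropy Theta (That t.+1)))).
    apply: ler_sum => t _; have [Q_gt0 Q1] := That_simplex t.
    by rewrite That_next eta_next cross_entropy_decrease.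
  have -> : \sum_(0 <= t < T)
      (cross_entropy Theta (That t) - cross_entropy Theta (That t.+1)) =
      cross_entropy Theta (That 0%N) - cross_entropy Theta (That T).
    rewrite -[RHS]opprB.
    rewrite -(telescope_sumr (fun t => cross_entropy Theta (That t))) // -sumrN.
    by apply: eq_bigr => t _; rewrite opprB.
  have [Q_gt0 Q1] := That_simplex T.
  rewrite That_0 cross_entropy_uniform // lnV // opprK lerBlDr lerDl.
  exact: cross_entropy_ge0.
have bd t : J t (That t) ^+ 2 <= b t * d t.
  by rewrite /b eta_next -step_size_sqr //; exact: J0.
rewrite -[leLHS]ger0_norm ?sumr_ge0 // -sqrtr_sqr ler_wsqrtr //.
apply: le_trans (cauchy_schwarz_sum T b_ge0 d_ge0 bd) _.
by rewrite ler_wpM2r // sumr_ge0.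
Qed.
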